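(* Let $k \ge 1$, let $V^k = (C^k[a,b], \Vert \cdot \Vert_{C^k})$ with $\Vert f \Vert_{C^k} = \sum_{i=0}^k \Vert f^{(i)} \Vert_\infty$, and let $W = (C[a,b], \Vert \cdot \Vert_\infty)$. Let $D^{(k)} : V^k \to W$ be the differentiation operator $D^{(k)} f = f^{(k)}$, and let $(D_h^{(k)})_{h \in (0,1)}$ be a family of bounded linear operators $D_h^{(k)} : V^k \to W$ (a finite difference scheme, i.e. numerical differentiation operators). Suppose that $(D_h^{(k)})$ is consistent. Then $(D_h^{(k)})$ is convergent if and only if it is stable.
   Context: Functions are real-valued, and $f^{(i)}$ denotes the $i$-th derivative of $f$. Definitions: - The numerical differentiation $(D_h^{(k)})$ is convergent if $\lim_{h \to 0} \Vert (D_h^{(k)} - D^{(k)}) f \Vert_\infty = 0$ for every $f \in V^k$. - It is consistent if there is a dense linear subspace $V_0$ of $V^k$ such that $\lim_{h \to 0} \Vert (D_h^{(k)} - D^{(k)}) f \Vert_\infty = 0$ for every $f \in V_0$. - It is stable if $\Vert D_h^{(k)} \Vert \le C$ (operator norm from $V^k$ to $W$) with $C$ independent of $h$. The upper limit of the range of $h$ is regarded as irrelevant, since only limits as $h \to 0$ are considered; thus stability means that there are $h_0 \in (0,1)$ and $C$ such that $\Vert D_h^{(k)} \Vert \le C$ for all $0 < h < h_0$. *)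

(* Defs.v *)
From HB Require Import structures.
From mathcomp Require Import all_boot all_order all_algebra.
From mathcomp Require Import all_classical all_reals all_analysis.
Set Implicit Arguments.
Unset Strict Implicit.
Unset Printing Implicit Defensive.
Import Order.TTheory GRing.Theory Num.Theory.
Import numFieldNormedType.Exports.
Local Open Scope classical_set_scope.
Local Open Scope ring_scope.

(** The interval [[a, b]] with its subtype topology: limits in it, hence
    derivatives and continuity at the endpoints, are one-sided. *)
Notation seg a b := (set_type `[a, b]%classic).

Section Derivative.
Context {R : realType} {a b : R}.
Implicit Types (f : seg a b -> R^o) (x y : seg a b).

Definition diffq f x y : R^o := (f y - f x) / (val y - val x).

Definition differentiable_on_seg f := forall x, cvg (diffq f x @ x^').

Definition derivs f : seg a b -> R^o := fun x => lim (diffq f x @ x^').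

Definition nderivs (i : nat) f : seg a b -> R^o := iter i derivs f.

Definition supnorm f : R := sup (range (fun x => `|f x|)).

Definition Ck_prop (k : nat) f :=
  (forall i, (i < k)%N -> differentiable_on_seg (nderivs i f)) /\
  (forall i, (i <= k)%N -> continuous (nderivs i f)).

Definition Ck_pred (k : nat) : {pred (seg a b -> R^o)} :=
  fun f => `[< Ck_prop k f >].

Lemma Ck_predP k f : reflect (Ck_prop k f) (f \in Ck_pred k).
Proof. by rewrite unfold_in; exact: asboolP. Qed.

Lemma diffqD f g x : diffq (f + g) x = diffq f x + diffq g x.
Proof. by apply/funext => y; rewrite /diffq /= !fctE -mulrDl opprD addrACA. Qed.

Lemma diffqZ (c : R) f x : diffq (c *: f) x = c *: diffq f x.
Proof.
by apply/funext => y; rewrite /diffq /= !fctE /= -scalerBr -scalerAl.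
Qed.

End Derivative.

Section Ck_closed.
Context {R : realType} {a b : R} (ab : a < b).
Local Notation I := (seg a b).
Implicit Types (f g : I -> R^o) (x : I).

Lemma dnbhs_seg_proper x : ProperFilter (x^').
Proof.
apply: Build_ProperFilter_ex => P /=.
case=> _ [[W oW <-] /= Wx WP].
have xab : val x \in `[a, b] by have := valP x; rewrite inE.
have : nbhs (val x) W by exact: open_nbhs_nbhs.
move=> /nbhs_ballP[e /= e0 eW].
suff [y [yab yx ye]] : exists y : R, [/\ y \in `[a, b], y != val x & ball (val x) e y].
  have yab' : y \in `[a, b]%classic by rewrite inE.
  exists (exist _ y yab'); apply: WP => /=; first exact: eW.
  by apply/eqP => /(congr1 val)/= yxE; rewrite yxE eqxx in yx.
move: xab; rewrite in_itv/= => /andP[ax xb].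
have [xltb|xgeb] := ltP (val x) b.
- pose d := Num.min (e / 2) (b - val x).
  have d0 : 0 < d by rewrite lt_min divr_gt0//= subr_gt0.
  have de : d <= e / 2 by rewrite ge_min lexx.
  have db : d <= b - val x by rewrite ge_min lexx orbT.
  exists (val x + d); split.
  + by rewrite in_itv/= (le_trans ax) ?lerDl ?(ltW d0)//= addrC -lerBrDr.
  + by rewrite gt_eqF// ltrDl.
  + rewrite -ball_normE/= opprD addrA subrr sub0r normrN gtr0_norm//.
    by rewrite (le_lt_trans de)// ltr_pdivrMr// mulr_natr mulr2n ltrDl.
- have ax' : a < val x by rewrite (lt_le_trans ab).
  pose d := Num.min (e / 2) (val x - a).
  have d0 : 0 < d by rewrite lt_min divr_gt0//= subr_gt0.
  have de : d <= e / 2 by rewrite ge_min lexx.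
  have db : d <= val x - a by rewrite ge_min lexx orbT.
  exists (val x - d); split.
  + rewrite in_itv/= lerBrDr addrC -lerBrDr db/=.
    by rewrite (le_trans _ xb)// gerBl ltW.
  + by rewrite lt_eqF// gtrBl.
  + rewrite -ball_normE/= opprB addrCA subrr addr0 gtr0_norm//.
    by rewrite (le_lt_trans de)// ltr_pdivrMr// mulr_natr mulr2n ltrDl.
Qed.

Local Instance dnbhs_seg_proper' x : ProperFilter (x^') := dnbhs_seg_proper x.

Lemma differentiable_on_segD f g : differentiable_on_seg f ->
  differentiable_on_seg g -> differentiable_on_seg (f + g).
Proof. by move=> df dg x; rewrite diffqD; apply: is_cvgD. Qed.

Lemma differentiable_on_segZ (c : R) f : differentiable_on_seg f ->
  differentiable_on_seg (c *: f).
Proof. by move=> df x; rewrite diffqZ; apply: is_cvgZl_tmp. Qed.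

Lemma derivsD f g : differentiable_on_seg f -> differentiable_on_seg g ->
  derivs (f + g) = derivs f + derivs g.
Proof.
move=> df dg; apply/funext => x; rewrite /derivs diffqD.
by rewrite limD.
Qed.

Lemma derivsZ (c : R) f : differentiable_on_seg f ->
  derivs (c *: f) = c *: derivs f.
Proof. by move=> df; apply/funext => x; rewrite /derivs diffqZ limZl_tmp. Qed.

Lemma nderivsD k f g i : (i <= k)%N -> Ck_prop k f -> Ck_prop k g ->
  nderivs i (f + g) = nderivs i f + nderivs i g.
Proof.
move=> ik [df _] [dg _]; elim: i ik => // i IH ik.
by rewrite /nderivs !iterS -/(nderivs _ _) IH ?(ltnW ik)// derivsD//;
  [exact: df|exact: dg].
Qed.

Lemma nderivsZ k (c : R) f i : (i <= k)%N -> Ck_prop k f ->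
  nderivs i (c *: f) = c *: nderivs i f.
Proof.
move=> ik [df _]; elim: i ik => // i IH ik.
by rewrite /nderivs !iterS -/(nderivs _ _) IH ?(ltnW ik)// derivsZ//; exact: df.
Qed.

Lemma Ck_propD k f g : Ck_prop k f -> Ck_prop k g -> Ck_prop k (f + g).
Proof.
move=> Cf Cg; split=> i ik.
  rewrite (nderivsD (ltnW ik) Cf Cg).
  by apply: differentiable_on_segD; [exact: Cf.1|exact: Cg.1].
rewrite (nderivsD ik Cf Cg) => x.
exact: cvgD (Cf.2 _ ik x) (Cg.2 _ ik x).
Qed.

Lemma Ck_propZ k (c : R) f : Ck_prop k f -> Ck_prop k (c *: f).
Proof.
move=> Cf; split=> i ik.
  by rewrite (nderivsZ c (ltnW ik) Cf); apply: differentiable_on_segZ; exact: Cf.1.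
by rewrite (nderivsZ c ik Cf) => x; exact: cvgZl_tmp (Cf.2 _ ik x).
Qed.

Lemma diffq0 x : diffq (0 : I -> R^o) x = 0.
Proof. by apply/funext => y; rewrite /diffq subrr mul0r. Qed.

Lemma derivs0 : derivs (0 : I -> R^o) = 0.
Proof.
apply/funext => x; rewrite /derivs diffq0.
by apply/cvg_lim => //; exact: cvg_cst.
Qed.

Lemma nderivs0 i : nderivs i (0 : I -> R^o) = 0.
Proof. by elim: i => // i IH; rewrite /nderivs iterS -/(nderivs _ _) IH derivs0. Qed.

Lemma Ck_prop0 k : Ck_prop k (0 : I -> R^o).
Proof.
split=> i ik; rewrite nderivs0 => x.
by rewrite diffq0; exact: is_cvg_cst.
exact: (@cst_continuous I R^o 0).
Qed.

Lemma Ck_submod_closed k : submod_closed (@Ck_pred R a b k).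
Proof.
split; first by apply/Ck_predP; exact: Ck_prop0.
by move=> c f g /Ck_predP Cf /Ck_predP Cg; apply/Ck_predP;
  apply: Ck_propD => //; exact: Ck_propZ.
Qed.

Lemma continuous_seg_bounded f : continuous f ->
  has_ubound (range (fun x => `|f x|)).
Proof.
move=> /(@subspace_valL_continuousP' R `[a, b]%classic R^o 0 f) cf.
have /compact_bounded[M [_ HM]] :=
  continuous_compact cf (@segment_compact R a b).
exists (M + 1) => _ [x _ <-]; apply: HM; first by rewrite ltrDl.
exists (val x); first by have := valP x; rewrite inE.
by rewrite -[in RHS](@valLK R R^o 0 `[a, b]%classic f).
Qed.

Lemma supnorm_ub f x : continuous f -> `|f x| <= supnorm f.
Proof.
by move=> cf; apply: ub_le_sup; [exact: continuous_seg_bounded|exists x].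
Qed.

Let a_seg : I.
Proof. by exists a; rewrite inE /= in_itv/= lexx ltW. Defined.

Lemma supnorm_le f (M : R) : (forall x, `|f x| <= M) -> supnorm f <= M.
Proof.
move=> fM; apply: ge_sup; first by exists `|f a_seg|, a_seg.
by move=> _ [x _ <-].
Qed.

Lemma supnorm_ge0 f : continuous f -> 0 <= supnorm f.
Proof. by move=> cf; rewrite (le_trans _ (supnorm_ub a_seg cf)). Qed.

Lemma supnormD f g : continuous f -> continuous g ->
  supnorm (f + g) <= supnorm f + supnorm g.
Proof.
move=> cf cg; apply: supnorm_le => x.
by rewrite (le_trans (ler_normD _ _))// lerD ?supnorm_ub.
Qed.

Lemma supnormZ (c : R) f : continuous f -> supnorm (c *: f) = `|c| * supnorm f.
Proof.
have le1 (d : R) g : continuous g -> supnorm (d *: g) <= `|d| * supnorm g.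
  move=> cg; apply: supnorm_le => x; rewrite fctE normrM.
  by rewrite ler_wpM2l// supnorm_ub.
move=> cf; apply/eqP; rewrite eq_le le1//=.
have [->|c0] := eqVneq c 0.
  by rewrite normr0 mul0r supnorm_ge0// scale0r; exact: (@cst_continuous I R^o 0).
rewrite -{1}(scale1r f) -(mulVf c0) -scalerA -ler_pdivlMl ?normr_gt0//.
by rewrite -normfV le1// => x; exact: cvgZl_tmp (cf x).
Qed.

End Ck_closed.

(** The proof of [a < b] is a parameter because [derivs] is linear only on a
    nondegenerate interval: otherwise its limits are along the empty filter. *)
Record Ck (R : realType) (a b : R) (ab : a < b) (k : nat) := MkCk {
  Ck_val :> seg a b -> R^o;
  Ck_valP : Ck_val \in Ck_pred k }.

Section Ck_normed.
Context {R : realType} {a b : R} {ab : a < b} {k : nat}.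

HB.instance Definition _ := [isSub for @Ck_val R a b ab k].
HB.instance Definition _ := [Choice of Ck ab k by <:].

HB.instance Definition _ := GRing.isSubmodClosed.Build R (seg a b -> R^o)
  (@Ck_pred R a b k) (Ck_submod_closed ab k).
HB.instance Definition _ := [SubChoice_isSubLmodule of Ck ab k by <:].

Definition Ck_norm (f : Ck ab k) : R := \sum_(i < k.+1) supnorm (nderivs i f).

Lemma Ck_propP (f : Ck ab k) : Ck_prop k f.
Proof. exact/Ck_predP/Ck_valP. Qed.

Lemma Ck_continuous (f : Ck ab k) i : (i < k.+1)%N -> continuous (nderivs i f).
Proof. by rewrite ltnS; exact: (Ck_propP f).2. Qed.

Lemma Ck_normD (f g : Ck ab k) : Ck_norm (f + g) <= Ck_norm f + Ck_norm g.
Proof.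
rewrite /Ck_norm -big_split/=; apply: ler_sum => i _.
rewrite (nderivsD ab (ltn_ord i : (i <= k)%N) (Ck_propP f) (Ck_propP g)).
by apply: (supnormD ab); exact: Ck_continuous.
Qed.

Lemma Ck_normZ (c : R) (f : Ck ab k) : Ck_norm (c *: f) = `|c| * Ck_norm f.
Proof.
rewrite /Ck_norm mulr_sumr; apply: eq_bigr => i _.
rewrite (nderivsZ ab c (ltn_ord i : (i <= k)%N) (Ck_propP f)).
by apply: (supnormZ ab); exact: Ck_continuous.
Qed.

Lemma Ck_norm0_eq0 (f : Ck ab k) : Ck_norm f = 0 -> f = 0.
Proof.
move=> /eqP; rewrite psumr_eq0; last first.
  by move=> i _; apply: (supnorm_ge0 ab); exact: Ck_continuous.
move=> /allP/(_ ord0); rewrite mem_index_enum => /(_ isT)/eqP f0.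
apply/val_inj/funext => x; apply/eqP; rewrite -normr_le0 -f0.
exact/supnorm_ub/(@Ck_continuous f 0%N).
Qed.

HB.instance Definition _ := Lmodule_isNormed.Build R (Ck ab k)
  Ck_normD Ck_normZ Ck_norm0_eq0.

Lemma Ck_normE (f : Ck ab k) :
  `|f| = \sum_(i < k.+1) supnorm (nderivs i f).
Proof. by []. Qed.

Lemma diffk_subproof (f : Ck ab k) : nderivs k f \in Ck_pred 0.
Proof. by apply/Ck_predP; split=> // -[|//] _; exact: Ck_continuous. Qed.

Definition diffk (f : Ck ab k) : Ck ab 0 := MkCk ab (diffk_subproof f).

End Ck_normed.

(** [Ck ab 0] serves as the space of continuous functions with the sup norm. *)
Lemma C0_normE (R : realType) (a b : R) (ab : a < b) (f : Ck ab 0) :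
  `|f| = supnorm f.
Proof. by rewrite Ck_normE big_ord1. Qed.

(** Meaningful for bounded [T] only: [sup] is 0 on a set without upper bound. *)
Definition opnorm (R : realType) (V W : normedModType R) (T : V -> W) : R :=
  sup [set `|T f| | f in [set f : V | `|f| <= 1]].

(** A family indexed by h in ]0, 1[ is given as a function on [R]; its values
    outside ]0, 1[ are never used, since [h] tends to 0 from the right. *)
Section Schemes.
Context {R : realType} {a b : R} {ab : a < b} {k : nat}.
Implicit Type Dh : R -> Ck ab k -> Ck ab 0.

Definition converges_at Dh (f : Ck ab k) :=
  `|Dh h f - diffk f| @[h --> 0^'+] --> 0.

Definition convergent Dh := forall f, converges_at Dh f.

Definition consistent Dh := exists V0 : {pred Ck ab k},
  [/\ submod_closed V0, dense [set` V0] & {in V0, forall f, converges_at Dh f}].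

Definition stable Dh := exists h0 C : R,
  0 < h0 < 1 /\ forall h, 0 < h < h0 -> opnorm (Dh h) <= C.

End Schemes.

(* Main.v *)
From HB Require Import structures.
Require Import Defs.
From mathcomp Require Import all_boot all_order all_algebra.
From mathcomp Require Import all_classical all_reals all_analysis.
Import Order.TTheory GRing.Theory Num.Theory.
Import numFieldNormedType.Exports.
Local Open Scope classical_set_scope.
Local Open Scope ring_scope.

(** This is the Lax equivalence principle for numerical differentiation: for a
    consistent scheme, stability and convergence are the same thing.

    Stability gives convergence ([stable_convergent]) by approximation. If [g]
    lies in the dense subspace on which the scheme converges, then
    [Dh f - f^(k)] is the sum of [Dh (f - g)], of [Dh g - g^(k)] and of
    [g^(k) - f^(k)]. The first and the last are small with [f - g], uniformly
    in [h], because [Dh] is uniformly bounded and differentiation is bounded;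
    the middle one tends to 0 with [h].

    Convergence gives stability ([convergent_stable]) by the Banach-Steinhaus
    theorem. Without stability there are steps [h_n] tending to 0 along which
    the operator norms are unbounded, whereas for each [f] the sequence
    [Dh_n f] is bounded because it converges. Passing to a sequence matters:
    for a fixed [f], convergence bounds [Dh f] only for [h] below a threshold
    that depends on [f], while the finitely many terms of a sequence that lie
    above the threshold do no harm.

    Banach-Steinhaus requires C^k[a, b] to be complete ([Ck_complete]). Each
    derivative converges uniformly along a Cauchy filter of C^k functions, and
    what has to be seen is that the limit of the derivatives is the derivative
    of the limit. By the mean value inequality ([diffq_bound]) the difference
    quotients at a fixed point also converge uniformly, in the second point,
    so the limit along the filter and the limit defining the derivative may be
    interchanged. *)

(** * The mean value inequality on a segment *)

Section MeanValue.
Context {R : realType} {a b : R}.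
Local Notation I := (seg a b).
Implicit Types (f : I -> R^o) (x y : I).

Lemma seg_ex (z : R) : z \in `[a, b] -> exists y : I, val y = z.
Proof.
move=> zab; have zI : z \in `[a, b]%classic by rewrite inE.
by exists (exist (fun z => is_true (z \in `[a, b]%classic)) z zI).
Qed.

(** The mean value theorem speaks of functions on the whole line and of
    two-sided derivatives; this extension carries functions on the segment
    there. The value chosen outside the segment is arbitrary. *)
Definition zero_ext f : R -> R := @valL_ R R (0 : R) `[a, b]%classic f.

Lemma zero_extE f x : zero_ext f (val x) = f x.
Proof. by rewrite -[in RHS](@valLK R R 0 `[a, b]%classic f). Qed.

(** At an interior point all small increments stay in the segment, so the
    one-sided notion of derivative built into the subtype topology agrees with
    the usual one. *)
Lemma is_derive_zero_ext f x : differentiable_on_seg f -> val x \in `]a, b[ ->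
  is_derive (val x) 1 (zero_ext f) (derivs f x).
Proof.
move=> df xab.
have /cvgrPdist_le dfx : diffq f x @ x^' --> derivs f x by exact: df.
have dF : h^-1 *: (zero_ext f (h *: 1 + val x) - zero_ext f (val x))
    @[h --> 0^'] --> derivs f x.
  apply/cvgrPdist_le => e e0.
  have := dfx e e0; case=> _ [[W oW <-] /= Wx WP].
  have nW : nbhs (val x) (W `&` `]a, b[%classic).
    apply: open_nbhs_nbhs; split; last by split.
    by apply: openI => //; exact: itv_open.
  have shift : (fun h : R => h *: 1 + val x) @ 0 --> val x.
    rewrite -[X in _ --> X]add0r -[X in X + _](scale0r (1 : R)).
    by apply: cvgD; [apply: cvgZr_tmp; exact: cvg_id|exact: cvg_cst].
  have [d /= d0 dW] := shift _ nW.
  exists d => //= h hd h0.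
  have [Wh hab] := dW _ hd.
  have [|y yE] := @seg_ex (h *: 1 + val x); first exact: subset_itv_oo_cc hab.
  have yx : y != x.
    apply: contra_neq h0 => yx; move/eqP: yE.
    by rewrite yx -subr_eq subrr eq_sym -[_ *: 1]/(h * 1) mulr1 => /eqP.
  have Wy : W (val y) by rewrite yE.
  have := WP y Wy yx.
  rewrite /diffq yE -yE !zero_extE yE -[_ *: 1]/(h * 1) mulr1 addrK.
  by rewrite [_ / h]mulrC.
split; first by apply/cvg_ex; exists (derivs f x).
exact/cvg_lim.
Qed.

(** The mean value inequality. The case [x = y] is harmless, since the quotient
    is then [0 / 0 = 0]; this makes the bound uniform over all [y]. *)
Lemma diffq_bound f (M : R) : differentiable_on_seg f -> continuous f ->
  (forall x, `|derivs f x| <= M) -> forall x y, `|diffq f x y| <= M.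
Proof.
move=> df cf dfM x y.
have M0 : 0 <= M by exact: le_trans (dfM x).
wlog xy : x y / val x < val y.
  move=> H; have [|yx|xy] := ltgtP (val x) (val y); first exact: H.
  - suff -> : diffq f x y = diffq f y x by exact: H.
    by rewrite /diffq -opprB -[val y - _]opprB invrN mulrNN.
  - by rewrite /diffq xy subrr invr0 mulr0 normr0.
have xab : val x \in `[a, b] by have := valP x; rewrite inE.
have yab : val y \in `[a, b] by have := valP y; rewrite inE.
have sub z : z \in `]val x, val y[ -> z \in `]a, b[.
  rewrite !in_itv/= => /andP[xz zy].
  by rewrite (le_lt_trans _ xz) ?(itvP xab)// (lt_le_trans zy) ?(itvP yab).
have [| |c cxy] :=
    @MVT R (zero_ext f) (zero_ext (derivs f)) (val x) (val y) xy.
- move=> r rxy; have [z zr] := seg_ex _ (subset_itv_oo_cc (sub _ rxy)).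
  move: rxy; rewrite -zr => zxy; rewrite zero_extE.
  by apply: is_derive_zero_ext => //; exact: sub.
- apply: (@continuous_subspaceW _ _ _ `[a, b]%classic); last first.
    exact/subspace_valL_continuousP'.
  by apply: subset_itv; rewrite bnd_simp ?(itvP xab) ?(itvP yab).
have [z <-] := seg_ex _ (subset_itv_oo_cc (sub _ cxy)).
by rewrite !zero_extE /diffq => ->; rewrite mulfK ?subr_eq0 ?gt_eqF.
Qed.

End MeanValue.

(** * Uniform limits *)

Section UniformLimits.
Context {R : realType} {V : normedModType R} {X : choiceType}.

(* In this section a limit in a type of functions is a uniform limit. *)
Import ArrowAsUniformType.

Lemma nonexpansive_cauchy_cvg (F : set_system V) {FF : ProperFilter F}
    (u : V -> X -> R^o) :
  (forall f g x, `|u f x - u g x| <= `|f - g|) -> cauchy F ->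
  exists g : X -> R^o, u @ F --> g.
Proof.
move=> u1 /cauchy_ballP cF.
have : cvg (u @ F : set_system (arrow_uniform_type X R^o)).
  apply: cauchy_cvg; apply/cauchy_ballP => e e0.
  have Fe := cF e e0; rewrite near_map2.
  apply: filterS Fe => -[f g] /=; rewrite -ball_normE/= => fg x.
  by rewrite -ball_normE/= (le_lt_trans (u1 f g x)).
by move=> /cvg_ex.
Qed.

Lemma uniform_cvg_pointwise (F : set_system V) {FF : Filter F}
    (u : V -> X -> R^o) (g : X -> R^o) :
  u @ F --> g -> forall x, u f x @[f --> F] --> g x.
Proof.
move=> /cvg_ballP ug x; apply/cvg_ballP => e e0.
by have := ug e e0; apply: filterS => f /(_ x).
Qed.

End UniformLimits.

(** * Completeness of C^k[a, b] *)

Section Completeness.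
Context {R : realType} {a b : R} {ab : a < b} {k : nat}.
Local Notation I := (seg a b).
Local Notation V := (Ck ab k).
Implicit Types (f g : V) (x y : I) (i : nat).

#[local] Instance dnbhs_seg_filter x : ProperFilter (x^') :=
  dnbhs_seg_proper ab x.

Lemma nderivsB i f g : (i <= k)%N ->
  nderivs i (f - g) = nderivs i f - nderivs i g.
Proof.
move=> ik; rewrite -[- g]scaleN1r.
rewrite (nderivsD ab ik (Ck_propP f) (Ck_propP (-1 *: g))).
by rewrite (nderivsZ ab _ ik (Ck_propP g)) scaleN1r.
Qed.

Lemma normr_nderivs_le i f x : (i <= k)%N -> `|nderivs i f x| <= `|f|.
Proof.
move=> ik; rewrite Ck_normE.
rewrite (le_trans (supnorm_ub x (Ck_continuous (f := f) ik)))//.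
rewrite (bigD1 (Ordinal (ik : i < k.+1)%N))//= lerDl sumr_ge0// => j _.
exact/(supnorm_ge0 ab)/Ck_continuous.
Qed.

(** Together with [normr_nderivs_le], this makes the derivatives and their
    difference quotients nonexpansive from C^k to the uniform norm. *)
Lemma normr_diffq_nderivs_le i f x y : (i < k)%N ->
  `|diffq (nderivs i f) x y| <= `|f|.
Proof.
move=> ik; apply: (diffq_bound (nderivs i f) `|f|).
- exact: (Ck_propP f).1.
- exact: (Ck_continuous (ltnW ik : (i < k.+1)%N)).
- by move=> z; exact: (normr_nderivs_le i.+1).
Qed.

(* Here too a limit of functions on the segment is a uniform limit. *)
Import ArrowAsUniformType.

(** The limits [g i] of the [i]-th derivatives are candidates for the
    derivatives of [g 0]. Uniform convergence of the difference quotients of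
    the [i]-th derivatives lets the limits along [F] and at [x] be exchanged,
    which yields that [g i] has derivative [g i.+1]. *)
Lemma Ck_complete (F : set_system V) : ProperFilter F -> cauchy F -> cvg F.
Proof.
move=> FF cF.
have [g ug] : exists g : nat -> I -> R^o,
    forall i, (i <= k)%N -> nderivs i (f : V) @[f --> F] --> g i.
  suff : forall i, exists g : I -> R^o,
      (i <= k)%N -> nderivs i (f : V) @[f --> F] --> g.
    by move=> /choice[g ug]; exists g.
  move=> i; have [ik|] := leqP i k; last by exists 0.
  have [] := nonexpansive_cauchy_cvg F (fun f => nderivs i f) _ cF.
    by move=> f g x; have := normr_nderivs_le i (f - g) x ik; rewrite nderivsB.
  by move=> g ug; exists g.
have pg i x : (i <= k)%N -> nderivs i (f : V) x @[f --> F] --> g i x.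
  by move=> /ug /uniform_cvg_pointwise.
have dg i x : (i < k)%N -> diffq (g i) x @ x^' --> g i.+1 x.
  move=> ik.
  have [] := nonexpansive_cauchy_cvg F (fun f => diffq (nderivs i f) x) _ cF.
    move=> f h y; have := normr_diffq_nderivs_le i (f - h) x y ik.
    rewrite nderivsB ?(ltnW ik)// -[- nderivs i h]scaleN1r diffqD diffqZ.
    by rewrite scaleN1r.
  (* The uniform limit q is identified through its pointwise values. *)
  move=> q uq.
  have qE : q = diffq (g i) x.
    apply/funext => y.
    have qy : diffq (nderivs i (f : V)) x y @[f --> F] --> q y.
      exact: (uniform_cvg_pointwise F _ _ uq y).
    apply: (cvg_unique (@norm_hausdorff R R^o) qy).
    by apply: cvgMr_tmp; apply: cvgB; apply: pg; exact: ltnW.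
  move: uq; rewrite qE => uq.
  apply: (cvg_switch_1 uq _ (pg i.+1 x ik)) => f.
  exact: (Ck_propP f).1.
have gE i : (i <= k)%N -> nderivs i (g 0) = g i.
  elim: i => // i IH ik; rewrite /nderivs iterS -/(nderivs _ _) IH ?(ltnW ik)//.
  by apply/funext => x; apply/cvg_lim => //; exact: dg.
have Cg : Ck_prop k (g 0).
  split=> i ik.
    move=> x; rewrite gE ?(ltnW ik)//; apply/cvg_ex.
    by exists (g i.+1 x); exact: dg.
  rewrite gE// => x.
  apply: (@cvg_switch_1 _ _ _ F FF (nbhs x) _ _ _ _ _ (ug i ik) _ (pg i x ik)).
  move=> f.
  exact: (Ck_propP f).2.
pose G : V := MkCk ab (introT (Ck_predP k _) Cg).
apply/cvg_ex; exists G; apply/cvgrPdist_le => e e0.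
(* The norm is a sum of k + 1 sup norms, each of which gets an equal share
   of e. *)
have e'0 : 0 < e / k.+1%:R by rewrite divr_gt0.
have : \forall f \near F, forall i : 'I_k.+1, forall x,
    ball (g i x : R^o) (e / k.+1%:R) (nderivs i (f : V) x).
  by apply: filter_forall => i; have /cvg_ballP := ug i (ltn_ord i); apply.
apply: filterS => f gf; rewrite Ck_normE.
have -> : e = \sum_(i < k.+1) e / k.+1%:R.
  by rewrite sumr_const card_ord -[RHS]mulr_natr divfK ?pnatr_eq0.
apply: ler_sum => i _; apply: (supnorm_le ab) => x.
have ik : (i <= k)%N := ltn_ord i.
by rewrite nderivsB// gE//; have := gf i x; rewrite -ball_normE => /ltW.
Qed.

HB.instance Definition _ := Uniform_isComplete.Build V Ck_complete.
End Completeness.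

(** * Operator norms *)

Section OperatorNorm.
Context {R : realType} {V W : normedModType R}.

Lemma opnorm_le (T : V -> W) (M : R) :
  (forall f, `|f| <= 1 -> `|T f| <= M) -> opnorm T <= M.
Proof.
move=> TM; apply: ge_sup; last by move=> _ [f f1 <-]; exact: TM.
by exists `|T 0|, 0 => //=; rewrite normr0.
Qed.

Lemma opnorm_ge0 (T : V -> W) : bounded_fun_norm T -> 0 <= opnorm T.
Proof.
move=> /(_ 1)[M TM]; apply: (@le_trans _ _ `|T 0|) => //.
apply: ub_le_sup; last by exists 0 => //=; rewrite normr0.
by exists M => _ [f f1 <-]; exact: TM.
Qed.

(** Boundedness makes the set in the definition of [opnorm] bounded above, so
    that its supremum dominates the values of [T] on the unit ball;
    homogeneity does the rest. *)
Lemma normr_opnorm_le (T : V -> W) (f : V) : linear T -> bounded_fun_norm T ->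
  `|T f| <= opnorm T * `|f|.
Proof.
move=> lT /(_ 1)[M TM].
pose L : {linear V -> W} := HB.pack T (GRing.isLinear.Build _ _ _ _ _ lT).
have TE : T =1 L by [].
have [->|f0] := eqVneq f 0; first by rewrite TE linear0 !normr0 mulr0.
rewrite -ler_pdivrMr ?normr_gt0// mulrC.
have -> : `|f|^-1 * `|T f| = `|T (`|f|^-1 *: f)|.
  by rewrite !TE linearZ normrZ normfV normr_id.
apply: ub_le_sup; first by exists M => _ [g g1 <-]; exact: TM.
exists (`|f|^-1 *: f) => //=.
by rewrite normrZ normfV normr_id mulVf ?normr_eq0.
Qed.

End OperatorNorm.

(** * Convergence and stability *)

Section Equivalence.
Context {R : realType} {a b : R} {ab : a < b} {k : nat}.
Local Notation V := (Ck ab k).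
Implicit Types (Dh : R -> V -> Ck ab 0) (f g : V).

Lemma normr_diffkB_le f g : `|diffk f - diffk g| <= `|f - g|.
Proof.
rewrite C0_normE; apply: (supnorm_le ab) => x.
have := normr_nderivs_le k (f - g) x (leqnn k).
by rewrite nderivsB.
Qed.

(** Banach-Steinhaus is applied to the operators [Dh (h n)] for steps [h n]
    that witness instability: [h n] tends to 0 and the operator norm of
    [Dh (h n)] exceeds [n]. *)
Lemma convergent_stable Dh :
  (forall h, 0 < h < 1 -> linear (Dh h)) ->
  (forall h, 0 < h < 1 -> bounded_fun_norm (Dh h)) ->
  convergent Dh -> stable Dh.
Proof.
move=> Dlin Dbnd cD; apply: contrapT => nstable.
(* The bound 1 / (n + 2) rather than 1 / (n + 1) keeps it below 1 for n = 0, as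
   the threshold in the definition of stability requires. *)
have : forall n : nat, exists h : R, 0 < h < n.+2%:R^-1 /\ n%:R < opnorm (Dh h).
  move=> n; apply: contrapT => nh; apply: nstable.
  exists n.+2%:R^-1, n%:R; split.
    by rewrite invr_gt0 ltr0n/= invf_lt1 ?ltr0n// ltr1n.
  by move=> h hn; rewrite leNgt; apply/negP => nD; apply: nh; exists h.
move=> /choice[h hP].
have h01 n : 0 < h n < 1.
  have [/andP[-> /lt_trans->]//] := hP n.
  by rewrite invf_lt1 ?ltr0n// ltr1n.
have h0 : h @ \oo --> 0^'+.
  move=> P [d /= d0 dP].
  have /cvgrPdist_lt/(_ d d0) := @cvg_harmonic R.
  apply: filterS => n; rewrite sub0r normrN => nd.
  have [/andP[hn0 hn] _] := hP n; apply: dP => //=.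
  rewrite sub0r normrN gtr0_norm// (lt_trans hn)// (le_lt_trans _ nd)//.
  by rewrite /= ger0_norm ?invr_ge0// lef_pV2 ?posrE// ler_nat.
have : uniform_bounded [set Dh (h n) | n in setT].
  apply: Banach_Steinhauss => [|f].
    by move=> _ [n _ <-]; split; [exact: Dbnd|exact: Dlin].
  have cf : (fun n => `|Dh (h n) f - diffk f|) @ \oo --> 0.
    exact: cvg_comp h0 (cD f).
  have [M [_ HM]] := cvg_seq_bounded (cvgP _ cf).
  exists (M + 1 + `|diffk f|) => _ [n _ <-].
  rewrite -lerBlDr (le_trans (lerB_dist _ _))//.
  have := HM (M + 1); rewrite ltrDl => /(_ ltr01 n Logic.I).
  by rewrite /= normr_id.
move=> /(_ 1)[M DM].
have [_] := hP (Num.truncn M).+1; apply/negP; rewrite -leNgt.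
apply: (@le_trans _ _ M); last first.
  by rewrite ltW// truncnS_gt.
by apply: opnorm_le => f; apply: DM; exists (Num.truncn M).+1.
Qed.

(** The approximation argument: [f - g] is taken so small that [|C| + 1] times
    its norm is at most [e / 2]. The summand [|C|] pays for [Dh (f - g)], and
    the summand 1 for the derivative of [g - f]. *)
Lemma stable_convergent Dh :
  (forall h, 0 < h < 1 -> linear (Dh h)) ->
  (forall h, 0 < h < 1 -> bounded_fun_norm (Dh h)) ->
  consistent Dh -> stable Dh -> convergent Dh.
Proof.
move=> Dlin Dbnd [V0 [_ dV0 cV0]] [h0 [C [/andP[h0_gt0 h01] DC]]] f.
apply/cvgrPdist_le => e e0.
pose d := e / 2 / (`|C| + 1).
have C1 : 0 < `|C| + 1 by rewrite ltr_wpDl.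
have d0 : 0 < d by rewrite !divr_gt0.
have [g [fg gV0]] : (ball f d `&` [set` V0]) !=set0.
  by apply: dV0; [exists f; exact: ballxx|exact: ball_open].
have {}fg : `|f - g| <= d by move: fg; rewrite -ball_normE => /ltW.
have /cvgrPdist_le cg := cV0 g gV0.
near=> h.
have hh0 : 0 < h < h0.
  by apply/andP; split; near: h; [exact: nbhs_right_gt|exact: nbhs_right_lt].
have hh1 : 0 < h < 1 by case/andP: hh0 => -> /lt_trans->.
rewrite sub0r normrN normr_id.
have -> : Dh h f - diffk f =
    Dh h (f - g) + (Dh h g - diffk g) + (diffk g - diffk f).
  have -> : Dh h (f - g) = Dh h f - Dh h g.
    by rewrite addrC -scaleN1r Dlin// scaleN1r addrC.
  by rewrite !subrKA.
rewrite (le_trans (ler_normD _ _))//.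
rewrite (le_trans (lerD (ler_normD _ _) (lexx _)))//.
rewrite addrAC (splitr e) lerD//.
  rewrite -(divfK (lt0r_neq0 C1) (e / 2)) -/d mulrDr mulr1 lerD//.
    rewrite (le_trans (normr_opnorm_le _ _ (Dlin _ hh1) (Dbnd _ hh1)))//.
    rewrite mulrC ler_pM// ?opnorm_ge0//; first exact: Dbnd.
    by rewrite (le_trans (DC h hh0))// ler_norm.
  by rewrite (le_trans (normr_diffkB_le _ _))// distrC.
near: h; have := cg (e / 2); rewrite divr_gt0// => /(_ isT).
by apply: filterS => h; rewrite sub0r normrN normr_id.
Unshelve. all: by end_near. Qed.

End Equivalence.

Theorem theorem5p2 (R : realType) (a b : R) (ab : a < b) (k : nat)
    (k_ge1 : (1 <= k)%N) (Dh : R -> Ck ab k -> Ck ab 0)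
    (Dh_linear : forall h : R, 0 < h < 1 -> linear (Dh h))
    (Dh_bounded : forall h : R, 0 < h < 1 -> bounded_fun_norm (Dh h)) :
  consistent Dh -> (convergent Dh <-> stable Dh).
Proof.
by move=> cDh; split; [exact: convergent_stable|exact: stable_convergent].
Qed.
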